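(* Let $a\ge 1$ and $n\ge 2$ be integers, and let $X_0\ge 0$ be an integer-valued random variable with $\mathbb{E}X_0<\infty$ that is not almost surely constant. Let $(X_k)_{k\ge 0}$ be the Derrida--Retaux sequence with the fixed number $n$ of terms, let $Q$ be its free energy, and let $F_0(s)=\mathbb{E}(s^{X_0})$. Put $$D_0(s)=(n-1)\,s\,F_0'(s)-a\,F_0(s).$$ Then: 1) If $D_0\big(n^{1/a}\big)>0$, then $Q>0$. 2) If $D_0\big(1+\tfrac{n-1}{a}\big)<0$, then $Q=0$.
   Context: The Derrida--Retaux sequence with a fixed number $n$ of terms, with parameters $a$ and $X_0$, is the sequence of (laws of) non-negative integer random variables defined by $$X_{k+1}\overset{d}{=}\big(X_k^{(1)}+X_k^{(2)}+\dots+X_k^{(n)}-a\big)^{+},\qquad k\ge 0,$$ where $x^+=\max(x,0)$ and $X_k^{(1)},\dots,X_k^{(n)}$ are independent copies of $X_k$. The free energy is $$Q=\lim_{k\to\infty}\frac{\mathbb{E}(X_k)}{n^k}.$$ This limit exists, since $\mathbb{E}(X_k)/n^k$ is non-increasing in $k$ and non-negative. The derivative is $F_0'(s)=\mathbb{E}(X_0 s^{X_0-1})$. Each inequality on $D_0(s)$ presupposes that $F_0(s)$ and $F_0'(s)$ are finite at the point $s$ in question, so that $D_0(s)$ is a well-defined real number. *)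

(* Defs.v *)
From HB Require Import structures.
From mathcomp Require Import all_boot all_order all_algebra.
From mathcomp Require Import all_classical all_reals all_analysis.
Set Implicit Arguments.
Unset Strict Implicit.
Unset Printing Implicit Defensive.
Import Order.TTheory GRing.Theory Num.Theory.
Import numFieldNormedType.Exports.
Local Open Scope classical_set_scope.
Local Open Scope ring_scope.

Lemma measurable_tuple_nat n (A : set (n.-tuple nat)) : measurable A.
Proof.
apply: countable_measurable => [t|]; last exact: countableP.
rewrite (_ : [set t] =
  \bigcap_(i in [set: 'I_n]) ((@tnth n nat) ^~ i) @^-1` [set tnth t i]).
  apply: fin_bigcap_measurable => [|i _]; first exact: finite_finset.
  by rewrite -[X in measurable X]setTI; exact: measurable_tnth.
apply/seteqP; split=> [_ -> i //|u h].
by apply: eq_from_tnth => i; exact: (h i I).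
Qed.

Section iid_samples.
Context {R : realType}.
Implicit Types (mu : probability nat R) (n : nat).

Definition tuple_cons n (p : nat * n.-tuple nat) : n.+1.-tuple nat :=
  [tuple of p.1 :: p.2].

Lemma measurable_tuple_cons n :
  measurable_fun [set: nat * n.-tuple nat] (@tuple_cons n).
Proof.
exact: (@measurable_cons _ _ _ _ fst n snd measurable_fst measurable_snd).
Qed.

HB.instance Definition _ n :=
  isMeasurableFun.Build _ _ _ _ (@tuple_cons n) (@measurable_tuple_cons n).

(* The n-fold product measure of mu: under [iid_law mu n] the coordinates
   [tnth ^~ i] are n independent copies of a variable of law mu, see
   [iid_law_rect]. *)
Fixpoint iid_law mu n : probability (n.-tuple nat) R :=
  match n with
  | 0 => \d_[tuple]
  | m.+1 => distribution (mu \x iid_law mu m)%E (@tuple_cons m)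
  end.

Lemma iid_law_rect mu n (A : 'I_n -> set nat) :
  iid_law mu n [set t | forall i, A i (tnth t i)]
  = (\prod_(i < n) mu (A i))%E.
Proof.
elim: n A => [|n IHn] A.
  rewrite big_ord0 /= diracE mem_set// => i; by case: i.
rewrite big_ord_recl -IHn -product_measure1E//; last exact: measurable_tuple_nat.
rewrite /= /distribution /pushforward; congr (product_measure1 _ _ _).
apply/seteqP; split=> [[x t] /= h|[x t] /= [h0 h] i].
  split=> [|i]; first exact: (h ord0).
  by have := h (lift ord0 i); rewrite tnthS.
by case: (unliftP ord0 i) => [j ->|->//]; rewrite tnthS.
Qed.

End iid_samples.

Section derrida_retaux.
Context {R : realType}.
Variables (n a : nat).

(* The subtraction is the truncated one of nat, i.e., the positive part. *)
Definition dr_map (t : n.-tuple nat) : nat := (\sum_(i < n) tnth t i - a)%N.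

Lemma measurable_dr_map : measurable_fun [set: n.-tuple nat] dr_map.
Proof. by move=> _ B _; exact: measurable_tuple_nat. Qed.

HB.instance Definition _ :=
  isMeasurableFun.Build _ _ _ _ dr_map measurable_dr_map.

Fixpoint dr_law (mu : probability nat R) (k : nat) : probability nat R :=
  match k with
  | 0 => mu
  | j.+1 => distribution (iid_law (dr_law mu j) n) dr_map
  end.

Local Open Scope ereal_scope.

Definition free_energy (mu : probability nat R) : \bar R :=
  limn (fun k => 'E_(dr_law mu k)[fun x => x%:R] * ((n%:R ^+ k)^-1)%:E).

Context d (T : measurableType d) (P : probability T R).

Definition gen_fun (X : {RV P >-> nat}) (s : R) : \bar R :=
  'E_P[fun w => (s ^+ X w)%R].

Definition gen_fun_deriv (X : {RV P >-> nat}) (s : R) : \bar R :=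
  'E_P[fun w => ((X w)%:R * s ^+ (X w).-1)%R].

(* Meaningful only where [gen_fun] and [gen_fun_deriv] are both finite. *)
Definition D_fun (X : {RV P >-> nat}) (s : R) : \bar R :=
  ((n%:R - 1) * s)%:E * gen_fun_deriv X s - a%:R%:E * gen_fun X s.

End derrida_retaux.

(* Main.v *)
Require Import Defs.
From HB Require Import structures.
From mathcomp Require Import all_boot all_order all_algebra.
From mathcomp Require Import all_classical all_reals all_analysis.
From mathcomp Require Import ring lra zify.
Set Implicit Arguments.
Unset Strict Implicit.
Unset Printing Implicit Defensive.
Import Order.TTheory GRing.Theory Num.Theory.
Import numFieldNormedType.Exports.
Local Open Scope classical_set_scope.
Local Open Scope ring_scope.
Local Open Scope ereal_scope.

(** Write W_k = E(s^X_k), T_k = E(X_k s^X_k) and D_k = (n-1) T_k - a W_k, which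
is the drift of the k-th law at s.  If Y is the sum of n independent copies of
X_k and X' = (Y - a)^+, then pointwise ([tilted_gap])

  ((n-1) X' - a) s^X' = s^-a ((n-1) Y - n a) s^Y
                        + s^-m (a + (n-1) m - a s^m),   m = (a - Y)^+.

The first term on the right has expectation n s^-a W_k^(n-1) D_k, so D_(k+1)
differs from this by the expectation of the second term.  That term is
nonnegative when 1 <= s <= n^(1/a), because a convex function lies below its
chord ([chord_ineq]), and nonpositive when s >= 1 + (n-1)/a, by the Bernoulli
inequality ([bernoulli_ineq]).  Thus the sign of the drift propagates along the
trajectory ([drift_step_ge], [drift_step_le]).  At s = 1 the drift is
(n-1) E(X_k) - a and is at least multiplied by n at each step, so the free energy
is positive as soon as D_k(1) > 0 for one k ([free_energy_gt0]), and zero if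
D_k(1) <= 0 for all k ([free_energy_eq0]).

Subcritical part.  At s = 1 + (n-1)/a every D_k is negative.  The coefficients
(n-1) i - a of the power series D_k change sign once, so D_k(1) <= 0 for all k
([drift_ge_drift1]) and the free energy vanishes.

Supercritical part.  Suppose that D_0(s0) > 0 with s0 = n^(1/a), but D_k(1) <= 0
for all k, that is, E(X_k) <= a/(n-1).  A large value M at one of the n^j
ancestors of a node loses at most a per generation, so if it occurred with
probability well above n^-j for j close to M/a, then X_(k+j) would have a large
mean.  Hence P(X_k = M) <= n^3 s0^-M for all k and M ([atom_bound]), and
for every s < s0 the tilted means T_k(s) are bounded uniformly in k
([tilted_mean_bounded]).  On the other hand D_0(s) > 0 for some s < s0
([drift_left_gt0]), and there D_k(s) >= (n s^-a)^k D_0(s) ([drift_pow_ge]),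
which tends to infinity: a contradiction. *)

(** * Elementary inequalities *)

Lemma bernoulli_ineq (R : realFieldType) (x : R) m : (0 <= x)%R ->
  (1 + x * m%:R <= (1 + x) ^+ m)%R.
Proof.
move=> x0; elim: m => [|m IHm]; first by rewrite mulr0 addr0 expr0.
rewrite exprS; apply: (@le_trans _ _ ((1 + x) * (1 + x * m%:R)))%R; last first.
  by rewrite ler_wpM2l// addr_ge0.
rewrite -natr1.
have : (0 <= x * (x * m%:R))%R by rewrite !mulr_ge0.
by lra.
Qed.

Lemma pow_sub1_le (R : realFieldType) (s : R) k : (1 <= s)%R ->
  (s ^+ k - 1 <= k%:R * (s ^+ k * (s - 1)))%R.
Proof.
move=> s1; elim: k => [|k IHk]; first by rewrite expr0 subrr mul0r.
rewrite -natr1 mulrDl mul1r exprS.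
have p0 : (1 <= s ^+ k)%R by rewrite exprn_ege1.
have : (k%:R * (s ^+ k * (s - 1)) <= k%:R * (s * s ^+ k * (s - 1)))%R.
  by rewrite ler_wpM2l// ler_wpM2r ?subr_ge0// ler_peMl// (le_trans _ p0).
have : (0 <= s ^+ k * (s - 1) * (s - 1))%R.
  by rewrite !mulr_ge0 ?subr_ge0// (le_trans _ p0).
by lra.
Qed.

(** Convexity of [s ^+ -]: by induction on [a], as the increment from [a] to
[a + 1] is at least the average increment between 0 and [m], by [pow_sub1_le]. *)
Lemma chord_ineq (R : realFieldType) (s : R) m a : (1 <= s)%R -> (m <= a)%N ->
  (a%:R * (s ^+ m - 1) <= m%:R * (s ^+ a - 1))%R.
Proof.
move=> s1 /subnK <-; elim: (a - m)%N => [|j IHj]; first by rewrite add0n.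
rewrite addSn -natr1 mulrDl mul1r exprS.
have h : (s ^+ m - 1 <= m%:R * (s ^+ (j + m) * (s - 1)))%R.
  apply: (le_trans (pow_sub1_le m s1)); rewrite ler_wpM2l// ler_wpM2r ?subr_ge0//.
  by rewrite ler_weXn2l// leq_addl.
by move: h IHj; lra.
Qed.

(** Since [(1 - q) ^+ N] and [(1 + q) ^+ N] have product at most 1, and the
second factor is at least [1 + q * N], the first one is small unless [N * q] is
bounded. *)
Lemma pow_half_bound (R : realFieldType) (q : R) N : (0 <= q)%R -> (q <= 1)%R ->
  (2^-1 <= (1 - q) ^+ N)%R -> (N%:R * q <= 1)%R.
Proof.
move=> q0 q1 h.
have h1 : ((1 - q) ^+ N * (1 + q) ^+ N <= 1)%R.
  rewrite -exprMn exprn_ile1//; first by nra.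
  by nra.
have h2 := bernoulli_ineq N q0.
have h3 : (2^-1 * (1 + q * N%:R) <= (1 - q) ^+ N * (1 + q) ^+ N)%R.
  by rewrite ler_pM// addr_ge0// mulr_ge0.
by lra.
Qed.

(** * Expectations of functions on the natural numbers *)

Lemma measurable_fun_tuple_nat n d (T : sigmaRingType d)
  (f : n.-tuple nat -> T) : measurable_fun [set: n.-tuple nat] f.
Proof. by move=> _ B _; exact: measurable_tuple_nat. Qed.

Lemma measurable_pair_nat n (A : set (nat * n.-tuple nat)) : measurable A.
Proof.
apply: countable_measurable => [[x t]|]; last exact: countableP.
rewrite (_ : [set (x, t)] = [set x] `*` [set t]).
  by apply: measurableX => //; exact: measurable_tuple_nat.
by apply/seteqP; split => [_ -> //|[y u] /= [-> ->]].
Qed.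

Lemma expectationE (R : realType) (mu : probability nat R) (f : nat -> R) :
  'E_mu[f] = \int[mu]_x (f x)%:E.
Proof. by rewrite unlock. Qed.

Lemma ge0_expectation_lincomb (R : realType) (mu : probability nat R)
    (f g : nat -> R) (b c : R) :
  (forall x, (0 <= f x)%R) -> (forall x, (0 <= g x)%R) ->
  (0 <= b)%R -> (0 <= c)%R ->
  'E_mu[fun x => (b * f x + c * g x)%R] = b%:E * 'E_mu[f] + c%:E * 'E_mu[g].
Proof.
move=> f0 g0 b0 c0; rewrite !expectationE.
under eq_integral do rewrite EFinD (EFinM b) (EFinM c).
rewrite ge0_integralD//; last 2 first.
- by move=> x _; rewrite -EFinM lee_fin mulr_ge0.
- by move=> x _; rewrite -EFinM lee_fin mulr_ge0.
by rewrite !ge0_integralZl// => x _; rewrite lee_fin.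
Qed.

Lemma ge0_expectation_le (R : realType) (mu : probability nat R)
    (f g : nat -> R) : (forall x, (0 <= f x)%R) ->
  (forall x, (f x <= g x)%R) -> 'E_mu[f] <= 'E_mu[g].
Proof.
move=> f0 fg; rewrite !expectationE; apply: ge0_le_integral => //.
- by move=> x _; rewrite lee_fin.
- by move=> x _; rewrite lee_fin.
Qed.

(** * Integration against the product law *)

Lemma integral_iid_lawS (R : realType) (mu : probability nat R) n
    (f : n.+1.-tuple nat -> \bar R) : (forall t, 0 <= f t) ->
  \int[iid_law mu n.+1]_t f t =
  \int[mu]_x \int[iid_law mu n]_t f (tuple_cons (x, t)).
Proof.
move=> f0.
rewrite /= ge0_integral_distribution//; first last.
  exact: measurable_fun_tuple_nat.
rewrite fubini_tonelli1//; last by move=> x; exact: f0.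
by move=> _ B _; exact: measurable_pair_nat.
Qed.

Lemma prode_const_ord (R : realType) n (x : \bar R) :
  \prod_(i < n) x = x ^+ n.
Proof. by rewrite big_const card_ord iter_mule mule1. Qed.

(** Tonelli's theorem, one coordinate at a time. *)
Lemma integral_iid_law_prod (R : realType) (mu : probability nat R) n
    (f : 'I_n -> nat -> R) : (forall i x, (0 <= f i x)%R) ->
  \int[iid_law mu n]_t (\prod_(i < n) f i (tnth t i))%:E =
  \prod_(i < n) 'E_mu[f i].
Proof.
elim: n f => [|n IHn] f f0.
  rewrite big_ord0 /= integral_dirac//; last exact: measurable_fun_tuple_nat.
  by rewrite diracT mul1e big_ord0.
have p0 (t : n.-tuple nat) :
    (0 <= \prod_(i < n) f (lift ord0 i) (tnth t i))%R.
  by apply: prodr_ge0 => i _; exact: f0.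
rewrite integral_iid_lawS; last first.
  by move=> t; rewrite lee_fin prodr_ge0.
rewrite big_ord_recl.
transitivity (\int[mu]_x ((f ord0 x)%:E *
    \prod_(i < n) 'E_mu[f (lift ord0 i)])).
  apply: eq_integral => x _.
  rewrite -(IHn (fun i => f (lift ord0 i)))// -ge0_integralZl ?lee_fin//.
  - apply: eq_integral => t _; rewrite big_ord_recl -EFinM.
    by congr (_ * _)%:E; apply: eq_bigr => i _; rewrite tnthS.
  - exact: measurable_fun_tuple_nat.
  - by move=> t _; rewrite lee_fin.
rewrite ge0_integralZr//; last 2 first.
- by move=> x _; rewrite lee_fin.
- by apply: prode_ge0 => i _; exact: expectation_ge0.
by rewrite expectationE.
Qed.

Definition weight {R : realType} (mu : probability nat R) (s : R) : \bar R :=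
  'E_mu[fun x => (s ^+ x)%R].

Definition tilted_mean {R : realType} (mu : probability nat R) (s : R) : \bar R :=
  'E_mu[fun x => (x%:R * s ^+ x)%R].

Lemma weight_at1 (R : realType) (mu : probability nat R) : weight mu 1 = 1.
Proof.
rewrite -[RHS](expectation_cst mu 1); congr ('E_mu[_]).
by apply/funext => x; rewrite expr1n.
Qed.

Lemma tilted_mean_at1 (R : realType) (mu : probability nat R) :
  tilted_mean mu 1 = 'E_mu[fun x => x%:R].
Proof.
by congr ('E_mu[_]); apply/funext => x; rewrite expr1n mulr1.
Qed.

Lemma integral_iid_law_weight (R : realType) (mu : probability nat R) n (s : R) :
  (0 <= s)%R ->
  \int[iid_law mu n]_t (s ^+ (\sum_(i < n) tnth t i)%N)%:E = weight mu s ^+ n.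
Proof.
move=> s0.
rewrite -prode_const_ord.
rewrite -(@integral_iid_law_prod _ _ _ (fun _ x => (s ^+ x)%R)); last first.
  by move=> _ x; exact: exprn_ge0.
by apply: eq_integral => t _; rewrite expr_sum.
Qed.

(** The sum is linear in its [n] terms, and each term, multiplied by the product
of the powers of [s], is again a product of one-coordinate functions. *)
Lemma integral_iid_law_tilted_mean (R : realType) (mu : probability nat R) n
    (s : R) : (0 <= s)%R ->
  \int[iid_law mu n]_t ((\sum_(i < n) tnth t i)%N%:R *
     s ^+ (\sum_(i < n) tnth t i)%N)%:E =
  n%:R%:E * (tilted_mean mu s * weight mu s ^+ n.-1).
Proof.
move=> s0.
pose f (i j : 'I_n) x : R := (if j == i then x%:R * s ^+ x else s ^+ x)%R.
have f0 i j x : (0 <= f i j x)%R.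
  by rewrite /f; case: ifP => _; rewrite ?mulr_ge0 ?exprn_ge0.
transitivity (\int[iid_law mu n]_t
    \sum_(i < n) (\prod_(j < n) f i j (tnth t j))%:E).
  apply: eq_integral => t _; rewrite sumEFin natr_sum mulr_suml.
  congr (_%:E); apply: eq_bigr => i _.
  rewrite expr_sum (bigD1 i)//= [in RHS](bigD1 i)//= {1}/f eqxx mulrA.
  by congr (_ * _)%R; apply: eq_bigr => j /negbTE ji; rewrite /f ji.
rewrite ge0_integral_sum//; last 2 first.
- by move=> i; exact: measurable_fun_tuple_nat.
- by move=> i t _; rewrite lee_fin prodr_ge0.
transitivity (\sum_(i < n) (tilted_mean mu s * weight mu s ^+ n.-1)).
  apply: eq_bigr => i _; rewrite integral_iid_law_prod//.
  rewrite (bigD1 i)//= {1}/f eqxx; congr (_ * _).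
  rewrite (eq_bigr (fun=> weight mu s)); last first.
    by move=> j /negbTE ji; rewrite /f ji.
  rewrite big_const cardC1 card_ord.
  by rewrite iter_mule mule1.
by rewrite sumr_const card_ord mule_natl.
Qed.

(** * One step of the recursion *)

Definition dr_step {R : realType} (n a : nat) (mu : probability nat R) :
  probability nat R := distribution (iid_law mu n) (@dr_map n a).

Lemma expectation_dr_step (R : realType) (n a : nat) (mu : probability nat R)
    (f : nat -> R) : (forall x, (0 <= f x)%R) ->
  'E_(dr_step n a mu)[f] =
  \int[iid_law mu n]_t (f (\sum_(i < n) tnth t i - a)%N)%:E.
Proof.
by move=> f0; rewrite expectationE ge0_integral_distribution.
Qed.

(** With [x] the truncated value and [m] the truncation deficit, one of the two
is zero.  If [m = 0] the last term vanishes and the identity is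
[s ^+ y = s ^+ a * s ^+ x]; if [x = 0], substitute [y = a - m].  The
terms are arranged so that, the last one apart, both sides are nonnegative and
integrate term by term. *)
Lemma tilted_gap (R : realFieldType) (n a y : nat) (s : R) : (0 < s)%R ->
  let x := (y - a)%N in let m := (a - y)%N in
  ((n%:R - 1) * (x%:R * s ^+ x) + s ^- a * (n%:R * a%:R) * s ^+ y =
   s ^- a * (n%:R - 1) * (y%:R * s ^+ y) + a%:R * s ^+ x +
   s ^- m * (a%:R + (n%:R - 1) * m%:R - a%:R * s ^+ m))%R.
Proof.
move=> s0 x m; rewrite /x /m.
have sn0 k : (s ^+ k != 0)%R by rewrite expf_neq0// gt_eqF.
case: (leqP a y) => ay.
  have /eqP -> : (a - y == 0)%N by rewrite subn_eq0.
  move: (y - a)%N (subnK ay) => k <-.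
  by rewrite natrD exprD expr0; field; exact: sn0.
have /eqP -> : (y - a == 0)%N by rewrite subn_eq0 ltnW.
move: (a - y)%N (subnK (ltnW ay)) => k <-.
by rewrite natrD exprD expr0; field; rewrite !sn0.
Qed.

Section one_step.
Context {R : realType}.
Variables (n a : nat) (mu : probability nat R) (s : R).
Hypothesis s1 : (1 <= s)%R.

Let s0 : (0 < s)%R. Proof. exact: lt_le_trans s1. Qed.
Let sge0 : (0 <= s)%R. Proof. exact: ltW. Qed.
Let sX0 k : (0 <= s ^+ k)%R. Proof. exact: exprn_ge0. Qed.
Let xsX0 k l : (0 <= l%:R * s ^+ k)%R. Proof. by rewrite mulr_ge0. Qed.

Lemma weight_ge1 : 1 <= weight mu s.
Proof.
have -> : 1 = 'E_mu[fun=> 1%R] by rewrite expectation_cst.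
rewrite /weight !expectationE; apply: ge0_le_integral => //.
- by move=> x _; rewrite lee_fin exprn_ege1.
Qed.

Let xstep (t : n.-tuple nat) := (\sum_(i < n) tnth t i - a)%N.
Let ysum (t : n.-tuple nat) := (\sum_(i < n) tnth t i)%N.

Lemma integral_step_l (c1 c2 : R) : (0 <= c1)%R -> (0 <= c2)%R ->
  \int[iid_law mu n]_t
     (c1 * ((xstep t)%:R * s ^+ xstep t) + c2 * s ^+ ysum t)%:E =
  c1%:E * tilted_mean (dr_step n a mu) s + c2%:E * weight mu s ^+ n.
Proof.
move=> c10 c20.
under eq_integral do rewrite EFinD (EFinM c1) (EFinM c2).
rewrite ge0_integralD//; do ?exact: measurable_fun_tuple_nat; last 2 first.
- by move=> t _; rewrite -EFinM lee_fin mulr_ge0.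
- by move=> t _; rewrite -EFinM lee_fin mulr_ge0.
rewrite !ge0_integralZl//; do ?exact: measurable_fun_tuple_nat; last 2 first.
- by move=> t _; rewrite lee_fin.
- by move=> t _; rewrite lee_fin.
by rewrite integral_iid_law_weight// /tilted_mean expectation_dr_step.
Qed.

Lemma integral_step_r (c1 c2 : R) : (0 <= c1)%R -> (0 <= c2)%R ->
  \int[iid_law mu n]_t
     (c1 * ((ysum t)%:R * s ^+ ysum t) + c2 * s ^+ xstep t)%:E =
  c1%:E * (n%:R%:E * (tilted_mean mu s * weight mu s ^+ n.-1)) +
  c2%:E * weight (dr_step n a mu) s.
Proof.
move=> c10 c20.
under eq_integral do rewrite EFinD (EFinM c1) (EFinM c2).
rewrite ge0_integralD//; do ?exact: measurable_fun_tuple_nat; last 2 first.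
- by move=> t _; rewrite -EFinM lee_fin mulr_ge0.
- by move=> t _; rewrite -EFinM lee_fin mulr_ge0.
rewrite !ge0_integralZl//; do ?exact: measurable_fun_tuple_nat; last 2 first.
- by move=> t _; rewrite lee_fin.
- by move=> t _; rewrite lee_fin.
by rewrite integral_iid_law_tilted_mean// /weight expectation_dr_step.
Qed.

Lemma weight_step_le : weight (dr_step n a mu) s <= weight mu s ^+ n.
Proof.
rewrite /weight expectation_dr_step// -integral_iid_law_weight//.
apply: ge0_le_integral => //; do ?exact: measurable_fun_tuple_nat.
- by move=> t _; rewrite lee_fin.
- by move=> t _; rewrite lee_fin ler_weXn2l// leq_subr.
Qed.

Lemma tilted_mean_step_le : tilted_mean (dr_step n a mu) s <=
  n%:R%:E * (tilted_mean mu s * weight mu s ^+ n.-1).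
Proof.
rewrite /tilted_mean expectation_dr_step// -integral_iid_law_tilted_mean//.
apply: ge0_le_integral => //; do ?exact: measurable_fun_tuple_nat.
- by move=> t _; rewrite lee_fin.
- move=> t _; rewrite lee_fin ler_pM ?ler_nat ?leq_subr//.
  by rewrite ler_weXn2l// leq_subr.
Qed.

Hypotheses (Wfin : weight mu s \is a fin_num)
  (Tfin : tilted_mean mu s \is a fin_num).

Lemma weight_step_fin : weight (dr_step n a mu) s \is a fin_num.
Proof.
rewrite ge0_fin_numE; last exact: expectation_ge0.
by rewrite (le_lt_trans weight_step_le)// ltey_eq fin_numX.
Qed.

Lemma tilted_mean_step_fin : tilted_mean (dr_step n a mu) s \is a fin_num.
Proof.
rewrite ge0_fin_numE; last exact: expectation_ge0.
by rewrite (le_lt_trans tilted_mean_step_le)// ltey_eq !fin_numM ?fin_numX.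
Qed.

End one_step.

(** The real-valued form of [D_fun] for a law on the natural numbers; [fine] makes
it meaningful only when both expectations are finite. *)
Definition drift {R : realType} (n a : nat) (mu : probability nat R) (s : R) : R :=
  ((n%:R - 1) * fine (tilted_mean mu s) - a%:R * fine (weight mu s))%R.

Section drift_step.
Context {R : realType}.
Variables (n a : nat) (mu : probability nat R) (s : R).
Hypotheses (n0 : (0 < n)%N) (s1 : (1 <= s)%R)
  (Wfin : weight mu s \is a fin_num) (Tfin : tilted_mean mu s \is a fin_num).

Let s0 : (0 < s)%R. Proof. exact: lt_le_trans s1. Qed.
Let sge0 : (0 <= s)%R. Proof. exact: ltW. Qed.
Let sX0 k : (0 <= s ^+ k)%R. Proof. exact: exprn_ge0. Qed.
Let xsX0 k l : (0 <= l%:R * s ^+ k)%R. Proof. by rewrite mulr_ge0. Qed.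
Let n1 : (0 <= n%:R - 1 :> R)%R. Proof. by rewrite subr_ge0 ler1n. Qed.
Let c0 : (0 <= s ^- a * (n%:R - 1))%R.
Proof. by rewrite mulr_ge0 ?invr_ge0. Qed.
Let c1 : (0 <= s ^- a * (n%:R * a%:R))%R.
Proof. by rewrite !mulr_ge0 ?invr_ge0. Qed.

(** Integrating [tilted_gap] over [n] independent copies: the gap term has the
sign given by the hypothesis on [s], and the remaining terms combine into the
drifts of the two laws. *)
Lemma drift_step_ge :
  (forall m, (m <= a)%N -> (a%:R * s ^+ m <= a%:R + (n%:R - 1) * m%:R)%R) ->
  (s ^- a * n%:R * fine (weight mu s) ^+ n.-1 * drift n a mu s <=
   drift n a (dr_step n a mu) s)%R.
Proof.
move=> h.
have : \int[iid_law mu n]_t (s ^- a * (n%:R - 1) *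
      ((\sum_(i < n) tnth t i)%N%:R * s ^+ (\sum_(i < n) tnth t i)%N) +
      a%:R * s ^+ (\sum_(i < n) tnth t i - a)%N)%:E <=
    \int[iid_law mu n]_t ((n%:R - 1) * ((\sum_(i < n) tnth t i - a)%N%:R *
      s ^+ (\sum_(i < n) tnth t i - a)%N) +
      s ^- a * (n%:R * a%:R) * s ^+ (\sum_(i < n) tnth t i)%N)%:E.
  apply: ge0_le_integral => //; do ?exact: measurable_fun_tuple_nat.
  - by move=> t _; rewrite lee_fin addr_ge0// mulr_ge0.
  - move=> t _; rewrite lee_fin tilted_gap// lerDl mulr_ge0 ?invr_ge0//.
    by rewrite subr_ge0 h// leq_subr.
rewrite integral_step_l// integral_step_r// /drift.
move: (weight_step_fin n a s1 Wfin) (tilted_mean_step_fin n a s1 Wfin Tfin).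
move: Wfin Tfin => /fineK <- /fineK <- /fineK <- /fineK <- /=.
rewrite -!EFin_expe -!EFinM -!EFinD lee_fin.
move: (fine _) (fine _) (fine _) (fine _) => t' w' w t.
have -> : (w ^+ n = w * w ^+ n.-1)%R by rewrite -exprS prednK.
by lra.
Qed.

(** The same integration, with the gap term of the opposite sign. *)
Lemma drift_step_le :
  (forall m, (a%:R + (n%:R - 1) * m%:R <= a%:R * s ^+ m)%R) ->
  (drift n a (dr_step n a mu) s <=
   s ^- a * n%:R * fine (weight mu s) ^+ n.-1 * drift n a mu s)%R.
Proof.
move=> h.
have : \int[iid_law mu n]_t ((n%:R - 1) * ((\sum_(i < n) tnth t i - a)%N%:R *
      s ^+ (\sum_(i < n) tnth t i - a)%N) +
      s ^- a * (n%:R * a%:R) * s ^+ (\sum_(i < n) tnth t i)%N)%:E <=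
    \int[iid_law mu n]_t (s ^- a * (n%:R - 1) *
      ((\sum_(i < n) tnth t i)%N%:R * s ^+ (\sum_(i < n) tnth t i)%N) +
      a%:R * s ^+ (\sum_(i < n) tnth t i - a)%N)%:E.
  apply: ge0_le_integral => //; do ?exact: measurable_fun_tuple_nat.
  - by move=> t _; rewrite lee_fin addr_ge0// mulr_ge0.
  - move=> t _; rewrite lee_fin tilted_gap// gerDl mulr_ge0_le0 ?invr_ge0//.
    by rewrite subr_le0 h.
rewrite integral_step_l// integral_step_r// /drift.
move: (weight_step_fin n a s1 Wfin) (tilted_mean_step_fin n a s1 Wfin Tfin).
move: Wfin Tfin => /fineK <- /fineK <- /fineK <- /fineK <- /=.
rewrite -!EFin_expe -!EFinM -!EFinD lee_fin.
move: (fine _) (fine _) (fine _) (fine _) => t' w' w t.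
have -> : (w ^+ n = w * w ^+ n.-1)%R by rewrite -exprS prednK.
by lra.
Qed.

End drift_step.

Lemma drift_at1 (R : realType) (n a : nat) (mu : probability nat R) :
  drift n a mu 1 = ((n%:R - 1) * fine ('E_mu[fun x => x%:R]) - a%:R)%R.
Proof. by rewrite /drift weight_at1 tilted_mean_at1 /= mulr1. Qed.

(** The coefficient [(n - 1) * x - a] is nonpositive up to [M = a %/ n.-1] and
positive beyond, exactly as [s ^+ x - s ^+ M] changes from nonpositive to
nonnegative; hence [((n - 1) * x - a) * (s ^+ x - s ^+ M)] is nonnegative for
every [x], and its expectation is the difference of the two sides. *)
Lemma drift_ge_drift1 (R : realType) (n a : nat) (mu : probability nat R)
    (s : R) : (1 < n)%N -> (1 <= s)%R ->
  weight mu s \is a fin_num -> tilted_mean mu s \is a fin_num ->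
  'E_mu[fun x => x%:R] \is a fin_num ->
  (s ^+ (a %/ n.-1) * drift n a mu 1 <= drift n a mu s)%R.
Proof.
move=> n1 s1 Wfin Tfin mfin; set M := (a %/ n.-1)%N.
have nB1 : (n%:R - 1 = n.-1%:R :> R)%R.
  by rewrite -{1}(prednK (ltnW n1)) -natr1 addrK.
have np0 : (0 < n.-1)%N by case: n n1 {nB1 M} => [|[]].
have s0 : (0 <= s)%R by rewrite (le_trans _ s1).
have sX0 k : (0 <= s ^+ k)%R by rewrite exprn_ge0.
have : 'E_mu[fun x => (n.-1%:R * s ^+ M * x%:R + a%:R * s ^+ x)%R] <=
       'E_mu[fun x => (n.-1%:R * (x%:R * s ^+ x) + a%:R * s ^+ M * 1)%R].
  apply: ge0_expectation_le => x; first by rewrite addr_ge0// !mulr_ge0.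
  rewrite mulr1 -subr_ge0.
  have -> : (n.-1%:R * (x%:R * s ^+ x) + a%:R * s ^+ M -
      (n.-1%:R * s ^+ M * x%:R + a%:R * s ^+ x) =
      ((x * n.-1)%N%:R - a%:R) * (s ^+ x - s ^+ M))%R by rewrite natrM; ring.
  have [xM|Mx] := leqP x M.
    rewrite mulr_le0// subr_le0 ?ler_weXn2l// ler_nat.
    by rewrite (leq_trans _ (leq_divM a n.-1))// leq_mul2r xM orbT.
  rewrite mulr_ge0// subr_ge0 ?ler_weXn2l ?ler_nat// ?(ltnW Mx)//.
  by rewrite ltnW// -ltn_divLR.
rewrite !ge0_expectation_lincomb//; do ?by move=> *; rewrite !mulr_ge0.
rewrite expectation_cst -/(weight mu s) -/(tilted_mean mu s) drift_at1 /drift nB1.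
move: Wfin Tfin mfin => /fineK <- /fineK <- /fineK <- /=.
rewrite -!EFinM -!EFinD lee_fin.
by move: (fine _) (fine _) (fine _) => p q r; lra.
Qed.

(** * Trajectories and the free energy *)

Section trajectory.
Context {R : realType}.
Variables (n a : nat) (mu : probability nat R).
Hypotheses (n1 : (1 < n)%N).
Let law k := dr_law n a mu k.
Let mean k := 'E_(law k)[fun x => x%:R].

Lemma dr_law_fin (s : R) k : (1 <= s)%R ->
  weight mu s \is a fin_num -> tilted_mean mu s \is a fin_num ->
  weight (law k) s \is a fin_num /\ tilted_mean (law k) s \is a fin_num.
Proof.
move=> s1 W0 T0; elim: k => [//|k [Wk Tk]]; split.
  exact: weight_step_fin.
exact: tilted_mean_step_fin.
Qed.

Hypothesis mean0_fin : 'E_mu[fun x => x%:R] \is a fin_num.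

Lemma dr_law_at1_fin k :
  weight (law k) 1 \is a fin_num /\ tilted_mean (law k) 1 \is a fin_num.
Proof.
by apply: dr_law_fin; rewrite ?weight_at1 ?tilted_mean_at1.
Qed.

Lemma mean_fin k : mean k \is a fin_num.
Proof. by rewrite /mean -tilted_mean_at1; apply: (dr_law_at1_fin k).2. Qed.

(** At [s = 1] every weight is 1 and the truncation can only increase the
drift, which is otherwise multiplied by [n]. *)
Lemma drift1_ge k j :
  (n%:R ^+ j * drift n a (law k) 1 <= drift n a (law (j + k)) 1)%R.
Proof.
elim: j => [|j IHj]; first by rewrite expr0 mul1r.
have [Wj Tj] := dr_law_at1_fin (j + k).
have := @drift_step_ge _ n a (law (j + k)) 1 (ltnW n1) (lexx 1) Wj Tj.
rewrite weight_at1 expr1n invr1 mul1r expr1n mulr1 => h.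
rewrite exprS -mulrA addSn; apply: le_trans (h _).
  by rewrite ler_wpM2l.
move=> m _; rewrite expr1n mulr1 lerDl mulr_ge0// subr_ge0 ler1n.
exact: ltnW.
Qed.

Lemma mean_le k : (fine (mean k.+1) <= n%:R * fine (mean k))%R.
Proof.
have := @tilted_mean_step_le _ n a (law k) 1 (lexx 1).
rewrite weight_at1 !tilted_mean_at1 -/(law k.+1) -/(mean k.+1) -/(mean k).
have -> : 1%:E ^+ n.-1 = 1 :> \bar R by rewrite -EFin_expe expr1n.
rewrite mule1; move: (mean_fin k) (mean_fin k.+1) => /fineK <- /fineK <-.
by rewrite -EFinM lee_fin.
Qed.

Let u k : R := (fine (mean k) / n%:R ^+ k)%R.

Let nX0 k : (0 < n%:R ^+ k :> R)%R.
Proof. by rewrite exprn_gt0// ltr0n ltnW. Qed.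

Lemma free_energyE : free_energy n a mu = limn (fun k => (u k)%:E).
Proof.
rewrite /free_energy; congr (limn _); apply/funext => k.
by rewrite /u EFinM fineK// mean_fin.
Qed.

(** A positive drift at [1] grows like [n ^+ k], so the mean, which dominates it
up to the factor [n - 1], is eventually of this order; the normalised means are
nonincreasing, so that their limit exists. *)
Lemma free_energy_gt0 k : (0 < drift n a (law k) 1)%R -> 0 < free_energy n a mu.
Proof.
move=> d0; rewrite free_energyE.
have nB0 : (0 < n%:R - 1 :> R)%R by rewrite subr_gt0 ltr1n.
apply: (@lt_le_trans _ _ (drift n a (law k) 1 / (n%:R - 1) / n%:R ^+ k)%:E).
  by rewrite lte_fin !divr_gt0.
apply: lime_ge.
  apply: ereal_nonincreasing_is_cvgn; apply/nonincreasing_seqP => j.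
  have -> : u j = (n%:R * fine (mean j) / n%:R ^+ j.+1)%R.
    rewrite /u exprS; field; rewrite gt_eqF//= pnatr_eq0 -lt0n.
    exact: ltnW.
  by rewrite lee_fin ler_wpM2r ?invr_ge0 ?mean_le// ltW.
near=> m.
have km : (k <= m)%N by near: m; exact: nbhs_infty_ge.
rewrite lee_fin /u ler_pdivlMr//.
have := drift1_ge k (m - k); rewrite subnK// (drift_at1 _ _ (law m)) -/(mean m) => h.
have -> : (drift n a (law k) 1 / (n%:R - 1) / n%:R ^+ k * n%:R ^+ m =
   (n%:R ^+ (m - k) * drift n a (law k) 1) / (n%:R - 1))%R.
  by rewrite -{1}(subnK km) exprD; field; rewrite !gt_eqF.
rewrite ler_pdivrMr//; apply: le_trans h _.
by rewrite lerBlDr mulrC lerDl.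
Unshelve. all: by end_near. Qed.

(** Nonpositive drift at [1] bounds all the means by [a]. *)
Lemma free_energy_eq0 :
  (forall k, (drift n a (law k) 1 <= 0)%R) -> free_energy n a mu = 0.
Proof.
move=> d0; rewrite free_energyE; apply/cvg_lim => //.
apply: cvg_EFin; first by near=> k.
apply: (@squeeze_cvgr _ _ _ _ (fun=> 0)%R (fun k => a%:R * n%:R^-1 ^+ k)%R).
- near=> k; rewrite /u mulr_ge0 ?fine_ge0 ?expectation_ge0//=.
  rewrite exprVn ler_wpM2r ?invr_ge0 ?(ltW (nX0 k))//.
  have := d0 k; rewrite drift_at1 -/(mean k) subr_le0; apply: le_trans.
  rewrite ler_peMl ?fine_ge0 ?expectation_ge0//.
  by rewrite lerBrDr -(natrD _ 1 1) ler_nat.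
- exact: cvg_cst.
- rewrite -[0%R](mulr0 a%:R); apply: cvgMl_tmp; apply: cvg_expr.
  by rewrite ger0_norm ?invr_ge0// invf_lt1 ?ltr1n// ltr0n ltnW.
Unshelve. all: by end_near. Qed.

End trajectory.

(** * Tails of the laws when the mean stays bounded *)

Definition below {R : realType} (mu : probability nat R) (M : nat) : R :=
  fine (mu [set x | (x < M)%N]).

Section tails.
Context {R : realType}.
Implicit Types (mu : probability nat R) (M : nat).

Lemma belowK mu M : (below mu M)%:E = mu [set x | (x < M)%N].
Proof. by rewrite fineK// fin_num_measure. Qed.

Lemma below_ge0 mu M : (0 <= below mu M)%R.
Proof. by rewrite -lee_fin belowK. Qed.

Lemma below_le1 mu M : (below mu M <= 1)%R.
Proof. by rewrite -lee_fin belowK probability_le1. Qed.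

(** The truncated sum is at least [tnth t i - a] for each [i], so if it is
below [M] then all [n] independent terms are below [M + a]. *)
Lemma below_step (n a : nat) mu M :
  (below (dr_step n a mu) M <= below mu (M + a) ^+ n)%R.
Proof.
rewrite -lee_fin belowK EFin_expe belowK.
rewrite -prode_const_ord -(iid_law_rect mu (fun=> [set x | (x < M + a)%N])).
rewrite /dr_step /distribution /pushforward /=.
apply: (le_measure (iid_law mu n)); rewrite ?inE; do ?exact: measurable_tuple_nat.
move=> t /= h i.
have M0 : (0 < M)%N by apply: leq_ltn_trans h.
apply: (@leq_ltn_trans (\sum_(j < n) tnth t j)%N).
  by rewrite (bigD1 i)//= leq_addr.
by move: h; rewrite /dr_map /=; lia.
Qed.

Lemma below_iter (n a : nat) mu k j M :
  (below (dr_law n a mu (j + k)) M <=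
   below (dr_law n a mu k) (M + j * a) ^+ (n ^ j))%R.
Proof.
elim: j M => [|j IHj] M; first by rewrite add0n mul0n addn0 expn0 expr1.
rewrite addSn; apply: le_trans (below_step _ _ _ _) _.
rewrite expnSr exprM lerXn2r ?nnegrE ?exprn_ge0 ?below_ge0//.
by rewrite mulSn addnA; exact: IHj.
Qed.

Lemma markov_below mu M : 'E_mu[fun x => x%:R] \is a fin_num ->
  (M%:R * (1 - below mu M) <= fine ('E_mu[fun x => x%:R]))%R.
Proof.
move=> mfin.
have : 'E_mu[fun=> M%:R] <=
    'E_mu[fun x => (1 * x%:R + M%:R * \1_[set x | (x < M)%N] x)%R].
  apply: ge0_expectation_le => x //; rewrite mul1r.
  have [xM|Mx] := ltnP x M.
    by rewrite indicE mem_set// mulr1 lerDr.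
  by rewrite (le_trans (_ : _ <= x%:R)%R) ?ler_nat// lerDl mulr_ge0.
rewrite ge0_expectation_lincomb// expectation_cst.
have -> : 'E_mu[\1_[set x | (x < M)%N]] = (below mu M)%:E.
  by rewrite belowK expectationE integral_indic// setIT.
rewrite -(fineK mfin) -!EFinM -!EFinD lee_fin.
by move: (fine _) (below _ _) => p q /=; lra.
Qed.

Lemma atom_le mu M B : (B <= M)%N -> (fine (mu [set M]) <= 1 - below mu B)%R.
Proof.
move=> BM; rewrite lerBrDr -lee_fin EFinD belowK fineK ?fin_num_measure//.
rewrite -measureU//; first by rewrite probability_le1.
by apply/seteqP; split => // x [/= ->]; rewrite ltnNge BM.
Qed.

(** Nonpositive drifts at [1] keep the means at most [a], so by the Markov
inequality each law gives mass at least 1/2 to the values below [2 * a].  By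
[below_iter] an event of probability [q] at time [k] which forces a value at
least [2 * a] at time [k + j] satisfies [(1 - q) ^+ (n ^ j) >= 1/2], hence
[q <= n ^- j].  The value [M] does so for [j = M %/ a - 2], and [s ^+ M] is at
most [n ^+ (M %/ a).+1]; the loss in the rounding is the factor [n ^+ 3]. *)
Lemma atom_bound (n a : nat) mu (s : R) k M : (0 < a)%N -> (1 < n)%N ->
  'E_mu[fun x => x%:R] \is a fin_num ->
  (forall k, (drift n a (dr_law n a mu k) 1 <= 0)%R) ->
  (1 <= s)%R -> (s ^+ a <= n%:R)%R ->
  (fine (dr_law n a mu k [set M]) * s ^+ M <= n%:R ^+ 3)%R.
Proof.
move=> a0 n1 mfin d0 s1 sa.
have n0 : (1 <= n%:R :> R)%R by rewrite ler1n ltnW.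
set p := fine _.
have p0 : (0 <= p)%R by rewrite fine_ge0.
have p1 : (p <= 1)%R by rewrite -lee_fin fineK ?fin_num_measure// probability_le1.
have half j : (2^-1 <= below (dr_law n a mu j) (2 * a))%R.
  have mjfin := mean_fin n a mfin j.
  have := markov_below (2 * a) mjfin.
  have := d0 j; rewrite drift_at1 natrM.
  have : (0 <= fine 'E_(dr_law n a mu j)[fun x => x%:R])%R.
    by rewrite fine_ge0// expectation_ge0.
  have : (2%:R <= n%:R :> R)%R by rewrite ler_nat.
  have : (1 <= a%:R :> R)%R by rewrite ler1n.
  move: (fine _) (below _ _) => m b ha hn m0 hd hm.
  have : (m <= (n%:R - 1) * m)%R by rewrite ler_peMl//; lra.
  move=> hm'; have : (2 * a%:R * (1 - b) <= a%:R)%R by lra.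
  rewrite -[X in (_ <= X)%R]mulr1 mulrAC mulrC ler_pM2l; last by lra.
  by lra.
have pj j : (2 * a + j * a <= M)%N -> (p * n%:R ^+ j <= 1)%R.
  move=> jM; set b := below (dr_law n a mu k) (2 * a + j * a).
  have h : (n%:R ^+ j * (1 - b) <= 1)%R.
    rewrite -natrX; apply: pow_half_bound.
    - by rewrite subr_ge0 below_le1.
    - by rewrite gerBl below_ge0.
    - rewrite subKr; apply: le_trans (half (j + k)%N) _.
      exact: below_iter.
  apply: le_trans h; rewrite mulrC ler_wpM2l ?exprn_ge0//.
  exact: atom_le.
have sM : (s ^+ M <= n%:R ^+ (M %/ a).+1)%R.
  apply: (@le_trans _ _ (s ^+ (a * (M %/ a).+1))%R).
    by rewrite ler_weXn2l// ltnW// mulnC ltn_ceil.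
  by rewrite exprM lerXn2r ?nnegrE ?exprn_ge0// (le_trans _ s1).
apply: (@le_trans _ _ (p * n%:R ^+ (M %/ a).+1)%R); first by rewrite ler_wpM2l.
(* For [M < 2 * a] no generation is available, but then [s ^+ M <= n ^+ 2]. *)
have [M2|M2] := leqP 2 (M %/ a).
  have := pj (M %/ a - 2)%N; rewrite -mulnDl subnKC// leq_divM => /(_ isT) h.
  have -> : (M %/ a).+1 = (M %/ a - 2 + 3)%N by lia.
  by rewrite exprD mulrA ler_piMl// exprn_ge0// (le_trans _ n0).
apply: (@le_trans _ _ (1 * n%:R ^+ (M %/ a).+1)%R).
  by rewrite ler_wpM2r// exprn_ge0.
by rewrite mul1r ler_weXn2l//; lia.
Qed.

Lemma expectation_le_geometric mu (f : nat -> R) (c r : R) :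
  (forall x, (0 <= f x)%R) -> (0 <= c)%R -> (0 < r < 1)%R ->
  (forall x, (f x * fine (mu [set x]) <= c * r ^+ x)%R) ->
  'E_mu[f] <= (c / (1 - r))%:E.
Proof.
move=> f0 c0 /andP[r0 r1] h; rewrite expectationE.
have -> : [set: nat] = \bigcup_k [set k].
  by apply/seteqP; split => // x _; exists x.
rewrite ge0_integral_bigcup//; last 2 first.
- by move=> x _; rewrite lee_fin.
- by move=> i j _ _ [x [/= <- <-]].
apply: lime_le.
  by apply: is_cvg_nneseries => i _ _; apply: integral_ge0 => x _; rewrite lee_fin.
near=> N; apply: (@le_trans _ _ (series (geometric c r) N)%:E); last first.
  by rewrite lee_fin geometric_le_lim// gtr0_norm.
rewrite /series/= -sumEFin; apply: lee_sum => i _.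
rewrite (eq_integral (fun=> (f i)%:E)); last first.
  by move=> x; rewrite inE => /= ->.
rewrite integral_cst//.
by have := h i; rewrite -lee_fin (EFinM (f i)) fineK ?fin_num_measure.
Unshelve. all: by end_near. Qed.

End tails.

(** * The two criteria for a law on the natural numbers *)

Section criteria.
Context {R : realType}.
Variables (n a : nat) (mu : probability nat R).
Hypotheses (a0 : (0 < a)%N) (n1 : (1 < n)%N).
Let law k := dr_law n a mu k.

(** By [atom_bound] the series of [x * s ^+ x] is dominated by [x * (s / s0) ^+ x]
up to a constant; replacing [s] by an intermediate [t] absorbs the factor [x],
since [1 + e * x <= (t / s) ^+ x] for [e = t / s - 1]. *)
Lemma tilted_mean_bounded (s s0 : R) :
  'E_mu[fun x => x%:R] \is a fin_num ->
  (forall k, (drift n a (law k) 1 <= 0)%R) ->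
  (1 <= s < s0)%R -> (s0 ^+ a <= n%:R)%R ->
  exists C : R, forall k, tilted_mean (law k) s <= C%:E.
Proof.
move=> mfin d0 /andP[s1 ss0] s0a.
have sp : (0 < s)%R by exact: lt_le_trans s1.
have [t st ts0] : exists2 t : R, (s < t)%R & (t < s0)%R.
  by exists ((s + s0) / 2)%R; lra.
have s0p : (0 < s0)%R by exact: lt_trans ss0.
have tp : (0 < t)%R by exact: lt_trans st.
pose e := (t / s - 1)%R.
have e0 : (0 < e)%R by rewrite subr_gt0 ltr_pdivlMr// mul1r.
have n3 : (0 <= n%:R ^+ 3 :> R)%R by rewrite exprn_ge0.
exists ((n%:R ^+ 3 / e) / (1 - t / s0))%R => k.
apply: expectation_le_geometric.
- by move=> x; rewrite mulr_ge0// exprn_ge0// ltW.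
- by rewrite divr_ge0// ltW.
- by rewrite divr_gt0//= ltr_pdivrMr// mul1r.
move=> x; set p := fine _.
have p0 : (0 <= p)%R by rewrite fine_ge0.
have xs : (x%:R * s ^+ x <= t ^+ x / e)%R.
  rewrite ler_pdivlMr//.
  have -> : (t ^+ x = (1 + e) ^+ x * s ^+ x)%R.
    by rewrite -exprMn /e addrC subrK divfK// gt_eqF.
  rewrite mulrAC ler_wpM2r ?exprn_ge0 ?(ltW sp)//.
  have := bernoulli_ineq x (ltW e0); apply: le_trans.
  by rewrite mulrC lerDr.
apply: (@le_trans _ _ (t ^+ x / e * p)%R); first by rewrite ler_wpM2r.
have := atom_bound k x a0 n1 mfin d0 (le_trans s1 (ltW ss0)) s0a.
rewrite -/p => h.
have -> : (t ^+ x / e * p = (p * s0 ^+ x) * ((t / s0) ^+ x / e))%R.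
  have u0 : (s0 ^+ x != 0)%R by rewrite expf_neq0// gt_eqF.
  have e1 : e != 0%R by rewrite gt_eqF.
  rewrite expr_div_n; move: (s0 ^+ x)%R (t ^+ x)%R u0 (e) e1 => u v u0 w w0.
  by field; rewrite u0 w0.
have -> : (n%:R ^+ 3 / e * (t / s0) ^+ x = n%:R ^+ 3 * ((t / s0) ^+ x / e))%R.
  by rewrite mulrAC mulrA.
by rewrite ler_wpM2r// divr_ge0 ?exprn_ge0 ?divr_ge0// ltW.
Qed.

Lemma drift_pow_ge (s : R) k : (1 <= s)%R -> (s ^+ a <= n%:R)%R ->
  weight mu s \is a fin_num -> tilted_mean mu s \is a fin_num ->
  (0 <= drift n a mu s)%R ->
  ((n%:R / s ^+ a) ^+ k * drift n a mu s <= drift n a (law k) s)%R.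
Proof.
move=> s1 sa W0 T0 d0.
have sp : (0 < s)%R by exact: lt_le_trans s1.
have c0 : (0 <= n%:R / s ^+ a)%R by rewrite divr_ge0// exprn_ge0// ltW.
elim: k => [|k IHk]; first by rewrite expr0 mul1r.
have [Wk Tk] := dr_law_fin n a k s1 W0 T0.
have chord m : (m <= a)%N -> (a%:R * s ^+ m <= a%:R + (n%:R - 1) * m%:R)%R.
  move=> ma; have := chord_ineq s1 ma.
  have : (m%:R * (s ^+ a - 1) <= m%:R * (n%:R - 1))%R by rewrite ler_wpM2l// lerB.
  by lra.
have := drift_step_ge (ltnW n1) s1 Wk Tk chord; apply: le_trans.
have dk0 : (0 <= drift n a (law k) s)%R.
  by apply: le_trans IHk; rewrite mulr_ge0// exprn_ge0.
have w1 : (1 <= fine (weight (law k) s) ^+ n.-1)%R.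
  by rewrite exprn_ege1// -lee_fin fineK// weight_ge1.
rewrite exprS -mulrA -[in leRHS]mulrA -[(_ * n%:R)%R]mulrC.
rewrite ler_wpM2l//; apply: le_trans IHk _.
by rewrite ler_peMl.
Qed.

(** The drift is continuous from the left: along a sequence increasing to [s0]
the tilted means converge by monotone convergence, while the weights stay below
the weight at [s0]. *)
Lemma drift_left_gt0 (s0 : R) : (1 < s0)%R ->
  weight mu s0 \is a fin_num -> tilted_mean mu s0 \is a fin_num ->
  (0 < drift n a mu s0)%R ->
  exists2 s : R, (1 <= s < s0)%R &
   [/\ weight mu s \is a fin_num, tilted_mean mu s \is a fin_num &
       (0 < drift n a mu s)%R].
Proof.
move=> s01 W0 T0 d0.
(* A convex combination of [s0] and 1, hence between 1 and [s0]. *)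
pose s (m : nat) : R := (s0 - (s0 - 1) * harmonic m)%R.
have h0 m : (0 < @harmonic R m)%R by rewrite invr_gt0.
have h1 m : (@harmonic R m <= 1)%R by rewrite invf_le1// ler1n.
have s1 m : (1 <= s m)%R.
  rewrite /s lerBrDr -lerBrDl; rewrite ler_piMr// subr_ge0; exact: ltW.
have ss0 m : (s m < s0)%R by rewrite gtrBl mulr_gt0// subr_gt0.
have sp m : (0 <= s m)%R by rewrite (le_trans _ (s1 m)).
have snd i j : (i <= j)%N -> (s i <= s j)%R.
  move=> ij; rewrite lerB// ler_wpM2l ?subr_ge0 ?(ltW s01)//.
  by rewrite lef_pV2 ?posrE// ler_nat.
have scvg : s m @[m --> \oo] --> s0.
  rewrite -[X in _ --> X]subr0 -[X in (_ - X)%R](mulr0 (s0 - 1)%R).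
  by apply: cvgB; [exact: cvg_cst|apply: cvgMl_tmp; exact: cvg_harmonic].
have Wle m : weight mu (s m) <= weight mu s0.
  apply: ge0_expectation_le => x; first by rewrite exprn_ge0.
  by rewrite lerXn2r ?nnegrE// ?(le_trans (sp m))// ltW.
have Tle m : tilted_mean mu (s m) <= tilted_mean mu s0.
  apply: ge0_expectation_le => x; first by rewrite mulr_ge0// exprn_ge0.
  by rewrite ler_wpM2l// lerXn2r ?nnegrE// ?(le_trans (sp m))// ltW.
have Wfin m : weight mu (s m) \is a fin_num.
  rewrite ge0_fin_numE; first by rewrite (le_lt_trans (Wle m))// ltey_eq W0.
  by apply: expectation_ge0 => x; rewrite exprn_ge0.
have Tfin m : tilted_mean mu (s m) \is a fin_num.
  rewrite ge0_fin_numE; first by rewrite (le_lt_trans (Tle m))// ltey_eq T0.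
  by apply: expectation_ge0 => x; rewrite mulr_ge0// exprn_ge0.
have Tcvg : tilted_mean mu (s m) @[m --> \oo] --> tilted_mean mu s0.
  pose g (m x : nat) : \bar R := (x%:R * s m ^+ x)%:E.
  have intg : (fun m => \int[mu]_x g m x) = (fun m => tilted_mean mu (s m)).
    by apply/funext => m; rewrite /tilted_mean expectationE.
  have intlim : \int[mu]_x limn (g^~ x) = tilted_mean mu s0.
    rewrite /tilted_mean expectationE; apply: eq_integral => x _.
    apply/cvg_lim => //; apply: cvg_EFin; first by near=> m.
    apply: cvgMl_tmp.
    exact: (@continuous_cvg _ R R _ _ s (fun r => r ^+ x)%R s0
      (@exprn_continuous R x s0) scvg).
  rewrite -intg -intlim; apply: cvg_monotone_convergence => //.
  - by move=> m x _; rewrite lee_fin mulr_ge0// exprn_ge0.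
  - move=> x _ i j ij; rewrite lee_fin ler_wpM2l// lerXn2r ?nnegrE//.
    exact: snd.
have nB0 : (0 < n%:R - 1 :> R)%R by rewrite subr_gt0 ltr1n.
have Tgt : (a%:R * fine (weight mu s0) / (n%:R - 1) < fine (tilted_mean mu s0))%R.
  by rewrite ltr_pdivrMr// (mulrC (fine (tilted_mean _ _))) -subr_gt0.
have [m _ hm] : \forall m \near \oo,
    (a%:R * fine (weight mu s0) / (n%:R - 1) < fine (tilted_mean mu (s m)))%R.
  apply: (@cvgr_gt _ _ _ _ _ (fine (tilted_mean mu s0))) => //.
  by apply: fine_cvg; rewrite fineK.
exists (s m); first by rewrite s1 ss0.
split => //; rewrite /drift subr_gt0.
have := hm m (leqnn m); rewrite /= ltr_pdivrMr// (mulrC (fine (tilted_mean _ _))).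
apply: le_lt_trans.
by rewrite ler_wpM2l// fine_le.
Unshelve. all: by end_near. Qed.

(** If the drift at [1] never becomes positive, then for some [r < s] the tilted
means at [r] are bounded, although [drift_pow_ge] makes them grow geometrically. *)
Lemma free_energy_supercritical (s : R) :
  'E_mu[fun x => x%:R] \is a fin_num -> (1 < s)%R -> (s ^+ a <= n%:R)%R ->
  weight mu s \is a fin_num -> tilted_mean mu s \is a fin_num ->
  (0 < drift n a mu s)%R -> 0 < free_energy n a mu.
Proof.
move=> mfin s1 sa W0 T0 d0.
case: (pselect (exists k, (0 < drift n a (law k) 1)%R)) => [[k]|nd].
  exact: free_energy_gt0.
have {}nd k : (drift n a (law k) 1 <= 0)%R.
  by rewrite leNgt; apply/negP => h; apply: nd; exists k.
have [r r1s [Wr Tr dr]] := drift_left_gt0 s1 W0 T0 d0.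
have [C hC] := tilted_mean_bounded mfin nd r1s sa.
have /andP[r1 rs] := r1s.
have rp : (0 < r)%R by exact: lt_le_trans r1.
have ra : (r ^+ a < n%:R)%R.
  by apply: lt_le_trans sa; rewrite ltrXn2r// ?lt0n_neq0// ltW.
pose e := (n%:R / r ^+ a - 1)%R.
have e0 : (0 < e)%R by rewrite subr_gt0 ltr_pdivlMr ?exprn_gt0// mul1r.
have nB0 : (0 < n%:R - 1 :> R)%R by rewrite subr_gt0 ltr1n.
have bnd k : (e * k%:R * drift n a mu r <= (n%:R - 1) * C)%R.
  have [Wk Tk] := dr_law_fin n a k r1 Wr Tr.
  apply: (@le_trans _ _ (drift n a (law k) r)).
    apply: le_trans (drift_pow_ge k r1 (ltW ra) Wr Tr (ltW dr)).
    rewrite ler_wpM2r ?(ltW dr)//.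
    have := bernoulli_ineq k (ltW e0).
    by rewrite {2}/e [(1 + (_ - 1))%R]addrC subrK; apply: le_trans; rewrite lerDr.
  apply: (@le_trans _ _ ((n%:R - 1) * fine (tilted_mean (law k) r))%R).
    rewrite /drift gerBl mulr_ge0// -lee_fin fineK//.
    by apply: le_trans (weight_ge1 _ r1).
  by rewrite ler_pM2l// -lee_fin fineK.
have ed0 : (0 < e * drift n a mu r)%R by rewrite mulr_gt0.
have b0 : (0 <= (n%:R - 1) * C / (e * drift n a mu r))%R.
  by have := bnd 0%N; rewrite mulr0 mul0r => h; rewrite divr_ge0// ltW.
have := archi_boundP b0; rewrite ltr_pdivrMr//.
by rewrite [ltRHS]mulrCA [ltRHS]mulrA ltNge bnd.
Qed.

(** The drift at [s] stays nonpositive along the trajectory, and the drift at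
[1] inherits its sign. *)
Lemma free_energy_subcritical (s : R) :
  'E_mu[fun x => x%:R] \is a fin_num -> (1 <= s)%R ->
  (forall m, (a%:R + (n%:R - 1) * m%:R <= a%:R * s ^+ m)%R) ->
  weight mu s \is a fin_num -> tilted_mean mu s \is a fin_num ->
  (drift n a mu s <= 0)%R -> free_energy n a mu = 0.
Proof.
move=> mfin s1 hs W0 T0 d0.
have sp : (0 < s)%R by exact: lt_le_trans s1.
apply: free_energy_eq0 => // k.
have [Wk Tk] := dr_law_fin n a k s1 W0 T0.
have mk := mean_fin n a mfin k.
have dk : (drift n a (law k) s <= 0)%R.
  elim: k {Wk Tk mk} => [//|k IHk].
  have [Wk Tk] := dr_law_fin n a k s1 W0 T0.
  apply: le_trans (drift_step_le (ltnW n1) s1 Wk Tk hs) _.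
  rewrite mulr_ge0_le0// !mulr_ge0 ?invr_ge0 ?exprn_ge0 ?(ltW sp)//.
  by rewrite fine_ge0// (le_trans _ (weight_ge1 _ s1)).
have := le_trans (drift_ge_drift1 a n1 s1 Wk Tk mk) dk.
by rewrite pmulr_rle0// exprn_gt0.
Qed.
End criteria.

(** * Transfer to random variables *)

Lemma weight_distribution (R : realType) d (T : measurableType d)
    (P : probability T R) (X : {RV P >-> nat}) (s : R) : (0 <= s)%R ->
  weight (distribution P X) s = gen_fun X s.
Proof.
move=> s0; rewrite /weight expectationE ge0_integral_distribution//.
  by rewrite /gen_fun unlock.
by move=> x; rewrite lee_fin exprn_ge0.
Qed.

Lemma mean_distribution (R : realType) d (T : measurableType d)
    (P : probability T R) (X : {RV P >-> nat}) :
  'E_(distribution P X)[fun x => x%:R] = 'E_P[fun w => (X w)%:R].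
Proof.
by rewrite expectationE ge0_integral_distribution// unlock.
Qed.

Lemma tilted_mean_distribution (R : realType) d (T : measurableType d)
    (P : probability T R) (X : {RV P >-> nat}) (s : R) : (0 <= s)%R ->
  tilted_mean (distribution P X) s = s%:E * gen_fun_deriv X s.
Proof.
move=> s0.
have -> : gen_fun_deriv X s = 'E_(distribution P X)[fun x => (x%:R * s ^+ x.-1)%R].
  rewrite expectationE ge0_integral_distribution//.
    by rewrite /gen_fun_deriv unlock.
  by move=> x; rewrite lee_fin mulr_ge0// exprn_ge0.
rewrite /tilted_mean !expectationE -ge0_integralZl//.
- by apply: eq_integral => -[|x] _; rewrite -EFinM ?mul0r ?mulr0// exprS mulrCA.
- by move=> x _; rewrite lee_fin mulr_ge0// exprn_ge0.
Qed.

Lemma D_fun_drift (R : realType) (n a : nat) d (T : measurableType d)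
    (P : probability T R) (X : {RV P >-> nat}) (s : R) : (0 <= s)%R ->
  gen_fun X s \is a fin_num -> gen_fun_deriv X s \is a fin_num ->
  D_fun n a X s = (drift n a (distribution P X) s)%:E.
Proof.
move=> s0 F0 F1; rewrite /drift weight_distribution// tilted_mean_distribution//.
rewrite /D_fun; move: F0 F1 => /fineK <- /fineK <-.
by rewrite -EFinM /= mulrA.
Qed.

Theorem theorem2 (R : realType) (a n : nat) (ha : (1 <= a)%N) (hn : (2 <= n)%N)
    (d : measure_display) (T : measurableType d) (P : probability T R)
    (X0 : {RV P >-> nat})
    (X0_mean : 'E_P[fun w => (X0 w)%:R] < +oo)
    (X0_nonconst : ~ exists c : nat, {ae P, forall w, X0 w = c}) :
  (let s : R := (n%:R `^ (a%:R^-1))%R in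
   gen_fun X0 s \is a fin_num -> gen_fun_deriv X0 s \is a fin_num ->
   0 < D_fun n a X0 s -> 0 < free_energy n a (distribution P X0)) /\
  (let s : R := (1 + (n%:R - 1) / a%:R)%R in
   gen_fun X0 s \is a fin_num -> gen_fun_deriv X0 s \is a fin_num ->
   D_fun n a X0 s < 0 -> free_energy n a (distribution P X0) = 0).
Proof.
set mu := distribution P X0.
have mfin : 'E_mu[fun x => x%:R] \is a fin_num.
  by rewrite mean_distribution ge0_fin_numE// expectation_ge0.
have a0 : (0 < a%:R :> R)%R by rewrite ltr0n.
have nB0 : (0 < n%:R - 1 :> R)%R by rewrite subr_gt0 ltr1n.
split=> s F0 F1.
  have s1 : (1 < s)%R.
    have <- : ((1 : R) `^ a%:R^-1 = 1)%R by rewrite powR1.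
    by rewrite gt0_ltr_powR ?invr_gt0 ?nnegrE// ltr1n.
  have s0 : (0 < s)%R := lt_trans ltr01 s1.
  have W0 : weight mu s \is a fin_num by rewrite weight_distribution// ltW.
  have T0 : tilted_mean mu s \is a fin_num.
    by rewrite tilted_mean_distribution ?fin_numM// ltW.
  rewrite D_fun_drift ?(ltW s0)// lte_fin.
  apply: free_energy_supercritical => //.
  by rewrite /s -powR_mulrn ?powR_ge0// -powRrM mulVf ?gt_eqF// powRr1.
have s1 : (1 <= s)%R by rewrite lerDl divr_ge0 ?ltW.
have s0 : (0 <= s)%R := le_trans ler01 s1.
rewrite D_fun_drift// lte_fin => d0.
apply: (@free_energy_subcritical _ _ _ _ _ s) => //.
- move=> m; have := bernoulli_ineq m (divr_ge0 (ltW nB0) (ltW a0)).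
  rewrite -(ler_pM2l a0) mulrDr mulr1 mulrA [(a%:R * (_ / _))%R]mulrC.
  by rewrite divfK ?gt_eqF.
- by rewrite weight_distribution.
- by rewrite tilted_mean_distribution ?fin_numM.
- exact: ltW.
Qed.
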